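(* Let $N$ be a finite set with $n=|N|\geq 2$. Then, for every set $S\subseteq\Upsilon(N)$ of enumerations of $N$, one has $S\in\mathcal{X}^{\circ}$ if and only if $S$ is geodetically convex in the permutohedral graph over $N$. In particular, for $S\subseteq\Upsilon(N)$, there exists a poset $P$ on $N$ with $S=\mathcal{L}(P)$ if and only if $S$ is a non-empty geodetically convex set of enumerations of $N$.
   Context: $N$ is a finite non-empty (unordered) set, $n=|N|$, $[n]=\{1,\ldots,n\}$. An enumeration of $N$ is a bijection $\varepsilon:[n]\to N$, with inverse $\varepsilon_{-1}:N\to[n]$; $\Upsilon(N)$ is the set of all enumerations of $N$. For $u,v\in N$, $u\preceq_{\varepsilon}v$ means $\varepsilon_{-1}(u)\leq\varepsilon_{-1}(v)$. For $T\subseteq N\times N$ put $\mathcal{L}(T)=\{\varepsilon\in\Upsilon(N): u\preceq_{\varepsilon}v \text{ for all }(u,v)\in T\}$. The class $\mathcal{X}^{\circ}$ consists of all sets of the form $\mathcal{L}(T)$ with $T\subseteq N\times N$. A poset on $N$ is a reflexive, antisymmetric and transitive relation $P\subseteq N\times N$; then $\mathcal{L}(P)$ is the set of its linear extensions. The permutohedral graph over $N$ is the undirected graph with node set $\Upsilon(N)$ in which $\varepsilon,\eta$ are adjacent iff they differ by an adjacent transposition: there is $1\leq i<n$ with $\varepsilon(i)=\eta(i+1)$, $\varepsilon(i+1)=\eta(i)$ and $\varepsilon(k)=\eta(k)$ for all $k\in[n]\setminus\{i,i+1\}$. This graph is connected. A geodesic between two nodes is a walk between them of shortest possible length. A node is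 between $\varepsilon$ and $\eta$ if it lies on some geodesic between $\varepsilon$ and $\eta$. A set $S$ of nodes is geodetically convex if, for all $\varepsilon,\eta\in S$, all nodes between $\varepsilon$ and $\eta$ belong to $S$ (in particular $\emptyset$ is geodetically convex). *)

(* Defs.v *)
From HB Require Import structures.
From mathcomp Require Import all_boot.

Set Implicit Arguments.
Unset Strict Implicit.
Unset Printing Implicit Defensive.

Section Enumerations.

Variable N : finType.

(* The index set [n] = {1, ..., n} is rendered as 'I_#|N| = {0, ..., n-1}. *)
Definition bijectiveb (f : {ffun 'I_#|N| -> N}) : bool :=
  injectiveb f && [forall u, exists i, f i == u].

Lemma bijectivebP (f : {ffun 'I_#|N| -> N}) :
  reflect (bijective f) (bijectiveb f).
Proof.
apply: (iffP andP) => [[/injectiveP injf _]|bijf].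
  by apply: inj_card_bij; rewrite ?card_ord.
split; first exact/injectiveP/bij_inj.
by have [g _ gK] := bijf; apply/forallP=> u; apply/existsP; exists (g u); rewrite gK.
Qed.

Record enumeration := Enumeration {
  enum_fun :> {ffun 'I_#|N| -> N};
  enum_funP : bijectiveb enum_fun
}.

HB.instance Definition _ := [isSub for enum_fun].
HB.instance Definition _ := [Finite of enumeration by <:].

Implicit Types (e h : enumeration) (u v : N).

Lemma enum_codom e u : u \in codom e.
Proof.
have /andP[_ /forallP/(_ u)/existsP[i /eqP <-]] := enum_funP e.
exact: codom_f.
Qed.

Definition enum_inv e u : 'I_#|N| := iinv (enum_codom e u).

Lemma enum_invK e : cancel (enum_inv e) e.
Proof. by move=> u; apply: f_iinv. Qed.

Lemma enum_funK e : cancel e (enum_inv e).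
Proof.
have /andP[/injectiveP inje _] := enum_funP e.
by move=> i; apply: inje; rewrite enum_invK.
Qed.

Definition enum_le e u v : bool := enum_inv e u <= enum_inv e v.

Definition Lset (T : {set N * N}) : {set enumeration} :=
  [set e | [forall p in T, enum_le e p.1 p.2]].

Definition Xcirc (S : {set enumeration}) : Prop :=
  exists T : {set N * N}, S = Lset T.

Definition is_poset (P : {set N * N}) : Prop :=
  [/\ forall u, (u, u) \in P,
      forall u v, (u, v) \in P -> (v, u) \in P -> u = v
    & forall u v w, (u, v) \in P -> (v, w) \in P -> (u, w) \in P].

Definition permutohedral_adj : rel enumeration := fun e h =>
  [exists i : 'I_#|N|, exists j : 'I_#|N|,
    [&& nat_of_ord j == i.+1, e i == h j, e j == h i &
        [forall k, (k != i) && (k != j) ==> (e k == h k)]]].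

End Enumerations.

Section Geodesics.

Variables (V : finType) (adj : rel V).

(* A walk from x to y is given by the sequence p of its nodes after x, so that
   its node sequence is x :: p and its length is size p. *)
Definition is_walk (x y : V) (p : seq V) : Prop := path adj x p /\ last x p = y.

Definition is_geodesic (x y : V) (p : seq V) : Prop :=
  is_walk x y p /\ forall q, is_walk x y q -> size p <= size q.

Definition between (x y z : V) : Prop :=
  exists2 p, is_geodesic x y p & z \in x :: p.

Definition geodetically_convex (S : {set V}) : Prop :=
  forall x y, x \in S -> y \in S -> forall z, between x y z -> z \in S.

End Geodesics.

(* Main.v *)
(** The distance of two enumerations in the permutohedral graph is the number
    of pairs which they order differently, so an enumeration lying between
    [x] and [y] keeps every precedence common to [x] and [y].  Hence sets
    [Lset T] are convex.  Conversely, let [S] be convex and non-empty, let [T]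
    be the intersection of the total orders in [S], and let [z] extend [T].
    Take [x] in [S] closest to [z].  If [x <> z], some consecutive pair [u, v]
    of [x] is reversed in [z]; so [(u, v)] is not in [T], that is, it is
    reversed in some [y] in [S].  Swapping [u] and [v] in [x] then gives an
    enumeration between [x] and [y], hence in [S], and closer to [z]. *)

Require Import Defs.
From mathcomp Require Import all_boot.
From mathcomp Require Import perm zify.

Set Implicit Arguments.
Unset Strict Implicit.
Unset Printing Implicit Defensive.

Section Inversions.

Variable N : finType.
Implicit Types (e h g x y z : enumeration N) (u v w : N) (S : {set enumeration N}).

(** * The strict order of an enumeration *)

Definition enum_lt e u v : bool := enum_inv e u < enum_inv e v.

Lemma enum_inv_inj e : injective (enum_inv e).
Proof. exact: can_inj (@enum_invK N e). Qed.

Lemma enum_leNgt e u v : enum_le e u v = ~~ enum_lt e v u.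
Proof. exact: leqNgt. Qed.

Lemma enum_lt_neqAle e u v : enum_lt e u v = (u != v) && enum_le e u v.
Proof. by rewrite /enum_lt ltn_neqAle (inj_eq val_inj) (inj_eq (@enum_inv_inj e)). Qed.

Lemma enum_ltnn e u : enum_lt e u u = false.
Proof. exact: ltnn. Qed.

Lemma enum_lt_neq e u v : enum_lt e u v -> u != v.
Proof. by rewrite enum_lt_neqAle => /andP[]. Qed.

Lemma enum_lt_asym e u v : enum_lt e u v -> enum_lt e v u = false.
Proof. by move=> uv; apply/negbTE; rewrite -enum_leNgt; apply: ltnW. Qed.

Lemma enum_lt_total e u v : u != v -> enum_lt e u v || enum_lt e v u.
Proof.
by move=> uv; rewrite [enum_lt e u v]enum_lt_neqAle uv enum_leNgt; case: enum_lt.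
Qed.

(** Makes positions recoverable from the strict order alone, so that this order determines the
    enumeration. *)
Lemma card_enum_lt e u : #|[set v | enum_lt e v u]| = enum_inv e u.
Proof.
have -> : [set v | enum_lt e v u] = e @: [set i : 'I_#|N| | i < enum_inv e u].
  apply/setP=> v; rewrite inE; apply/idP/imsetP => [vu|[i]].
    by exists (enum_inv e v); rewrite ?inE ?enum_invK.
  by rewrite inE => iu ->; rewrite /enum_lt enum_funK.
rewrite card_imset; last exact: can_inj (@enum_funK N e).
rewrite -sum1dep_card -(big_ord_widen _ (fun=> 1)).
  by rewrite sum1_card card_ord.
exact/ltnW/ltn_ord.
Qed.

Lemma enum_lt_ext e h : enum_lt e =2 enum_lt h -> e = h.
Proof.
move=> eh.
have inv_eq u : enum_inv e u = enum_inv h u.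
  apply: val_inj; rewrite /= -!card_enum_lt.
  by congr #|pred_of_set _|; apply/setP=> v; rewrite !inE eh.
apply/val_inj/ffunP=> i.
by apply: (@enum_inv_inj h); rewrite -inv_eq !enum_funK.
Qed.

(** * Inversion sets *)

(** Each discordant pair is recorded once, oriented as in [e], so the cardinality counts unordered
    pairs. *)
Definition inversions e h : {set N * N} :=
  [set p | enum_lt e p.1 p.2 && enum_lt h p.2 p.1].

Lemma mem_inversions e h u v :
  ((u, v) \in inversions e h) = enum_lt e u v && enum_lt h v u.
Proof. by rewrite inE. Qed.

Lemma inversions_id e : inversions e e = set0.
Proof.
apply/setP=> -[u v]; rewrite mem_inversions inE.
by case uv: enum_lt => //=; apply: enum_lt_asym.
Qed.

Lemma inversions_eq0 e h : inversions e h = set0 -> e = h.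
Proof.
move=> inv0.
have sub u v : enum_lt e u v -> enum_lt h u v.
  move=> uv; have := mem_inversions e h u v; rewrite inv0 inE uv /= => /esym hvu.
  by have := enum_lt_total h (enum_lt_neq uv); rewrite hvu orbF.
apply: enum_lt_ext => u v; apply/idP/idP => [|uv]; first exact: sub.
have /orP[//|/sub] := enum_lt_total e (enum_lt_neq uv).
by rewrite (enum_lt_asym uv).
Qed.

Lemma inversions_triangle x z y :
  inversions x y \subset inversions x z :|: inversions z y.
Proof.
apply/subsetP=> -[u v]; rewrite in_setU !mem_inversions => /andP[xuv yvu].
rewrite xuv yvu andbT /= orbC.
exact: enum_lt_total (enum_lt_neq xuv).
Qed.

(** * Consecutive pairs and adjacent transpositions *)

Definition consecutive e u v : Prop := enum_inv e v = (enum_inv e u).+1 :> nat.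

Lemma consecutive_lt e u v : consecutive e u v -> enum_lt e u v.
Proof. by rewrite /enum_lt => ->. Qed.

(** Let [w] directly follow [u] in [e]. Either [h] reverses [u] and [w], or [v] still precedes [w]
    in [h] and the gap in [e] has shrunk. *)
Lemma inversion_consecutive e h u v :
    enum_lt e u v -> enum_lt h v u ->
  exists a b, consecutive e a b /\ enum_lt h b a.
Proof.
(* [k] counts the elements strictly between [u] and [v] in [e]. *)
rewrite {1}/enum_lt => /subnKC; rewrite addSnnS; move: (_ - _) => k.
elim: k u => [|k IHk] u pos_v hvu.
  by exists u, v; split=> //; rewrite /consecutive -pos_v addn1.
have lt_w : (enum_inv e u).+1 < #|N|.
  by apply: leq_trans (ltn_ord (enum_inv e v)); lia.
pose w := e (Ordinal lt_w).
have uw : consecutive e u w by rewrite /consecutive enum_funK.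
case: (boolP (enum_lt h w u)) => [hwu|]; first by exists u, w.
rewrite -enum_leNgt => huw; apply: (IHk w); last exact: leq_trans hvu huw.
by rewrite uw addSnnS.
Qed.

Lemma swap_subproof e u v : bijectiveb [ffun k => tperm u v (e k)].
Proof.
apply/bijectivebP.
exists (fun w => enum_inv e (tperm u v w)) => [k|w]; rewrite !ffunE.
  by rewrite tpermK enum_funK.
by rewrite enum_invK tpermK.
Qed.

Definition swap e u v : enumeration N := Enumeration (swap_subproof e u v).

Lemma enum_inv_swap e u v w : enum_inv (swap e u v) w = enum_inv e (tperm u v w).
Proof.
rewrite -[in LHS](tpermK u v w) -[in LHS](enum_invK e (tperm u v w)).
have -> : tperm u v (e (enum_inv e (tperm u v w))) =
          swap e u v (enum_inv e (tperm u v w)) by rewrite /= ffunE.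
exact: enum_funK.
Qed.

(** No third element sits between [u] and [v], so only their mutual order changes. *)
Lemma enum_lt_swap e u v a b : consecutive e u v ->
  enum_lt (swap e u v) a b =
    ((a, b) == (v, u)) || enum_lt e a b && ((a, b) != (u, v)).
Proof.
move=> uv; rewrite /enum_lt !enum_inv_swap !xpair_eqE.
(* With equalities tested on positions, the goal becomes arithmetic in the positions of [u], [a] and
   [b]. *)
have eq_pos c d : (c == d) = (enum_inv e c == enum_inv e d :> nat).
  by rewrite (inj_eq val_inj) (inj_eq (@enum_inv_inj e)).
rewrite !permE /= !(fun_if (fun w => nat_of_ord (enum_inv e w))) !eq_pos uv.
move: (nat_of_ord _) (nat_of_ord _) (nat_of_ord _) => i j k.
by do 4!case: eqP => ?; lia.
Qed.

Lemma adj_is_swap e h :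
  permutohedral_adj e h -> exists2 p, consecutive e p.1 p.2 & h = swap e p.1 p.2.
Proof.
case/existsP=> i /existsP[j] /and4P[/eqP ji /eqP eihj /eqP ejhi /forallP eqk].
exists (e i, e j) => /=; first by rewrite /consecutive !enum_funK.
apply/val_inj/ffunP=> k; rewrite /= ffunE.
have [->|ki] := eqVneq k i; first by rewrite tpermL.
have [->|kj] := eqVneq k j; first by rewrite tpermR.
have /eqP <- := implyP (eqk k) (introT andP (conj ki kj)).
by rewrite tpermD // (inj_eq (can_inj (@enum_funK N e))) eq_sym.
Qed.

Lemma adj_swap e u v : consecutive e u v -> permutohedral_adj e (swap e u v).
Proof.
move=> uv; apply/existsP; exists (enum_inv e u); apply/existsP; exists (enum_inv e v).
rewrite uv eqxx /= !ffunE !enum_invK tpermL tpermR !eqxx /=.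
apply/forallP=> k; apply/implyP=> /andP[ku kv]; rewrite ffunE tpermD //.
  by apply: contraNneq ku => ->; rewrite enum_funK.
by apply: contraNneq kv => ->; rewrite enum_funK.
Qed.

Lemma inversions_swap_sub e g u v : consecutive e u v ->
  inversions e g \subset (u, v) |: inversions (swap e u v) g.
Proof.
move=> uv; apply/subsetP=> -[a b]; rewrite in_setU1 !mem_inversions enum_lt_swap //.
by case/andP=> -> ->; case: eqP; rewrite ?orbT.
Qed.

(** The swap removes the inversion [(u, v)] and creates none, since its new precedence agrees with
    [g]. *)
Lemma card_inversions_swap e g u v : consecutive e u v -> enum_lt g v u ->
  #|inversions e g| = #|inversions (swap e u v) g|.+1.
Proof.
move=> uv gvu; have euv := consecutive_lt uv.
have uvN : (u, v) \notin inversions (swap e u v) g.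
  rewrite mem_inversions gvu andbT enum_lt_swap // eqxx andbF orbF xpair_eqE.
  by apply: contraTN euv => /andP[/eqP-> _]; rewrite enum_ltnn.
(* [uvN] turns the summand 1 into the boolean of [cardsU1], so the right side is the size of a
   union. *)
rewrite -add1n -[1]/(true : nat) -uvN -cardsU1.
apply: eq_card => -[a b].
apply/idP/idP; first exact: (subsetP (inversions_swap_sub _ _)).
rewrite in_setU1 !mem_inversions enum_lt_swap // => /orP[/eqP[-> ->]|].
  by rewrite euv gvu.
case/andP=> /orP[/eqP[-> ->]|/andP[-> _] ->] //.
by rewrite (enum_lt_asym gvu).
Qed.

(** * Distance and geodesics *)

(** Each step removes at most one inversion with the endpoint, and none is left on arrival. *)
Lemma card_inversions_walk x p :
  path (@permutohedral_adj N) x p -> #|inversions x (last x p)| <= size p.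
Proof.
elim: p x => [|h p IHp] x /=; first by rewrite inversions_id cards0.
case/andP=> /adj_is_swap[[u v] /= uv ->] /IHp le_p.
apply: leq_trans (subset_leq_card (inversions_swap_sub _ uv)) _.
by rewrite cardsU1; case: (_ \notin _) => //=; apply: leqW.
Qed.

(** Bubble sort: while inversions remain, one of them is consecutive in [x], and swapping it lowers
    their number by one. *)
Lemma inversions_walk x y :
  exists2 p, is_walk (@permutohedral_adj N) x y p & size p = #|inversions x y|.
Proof.
move: {2}#|_| (erefl #|inversions x y|) => n; elim: n x => [|n IHn] x card_n.
  by exists [::]; rewrite ?card_n //; split=> //=; apply/inversions_eq0/cards0_eq.
have /card_gt0P[[a b]] : 0 < #|inversions x y| by rewrite card_n.
rewrite mem_inversions => /andP[xab yba].
have [u [v [uv yvu]]] := inversion_consecutive xab yba.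
move: card_n; rewrite (card_inversions_swap uv yvu) => -[/[dup] card_n /IHn].
case=> p [path_p last_p] size_p; exists (swap x u v :: p); last by rewrite /= size_p.
by split; rewrite //= adj_swap.
Qed.

Lemma size_geodesic x y p :
  is_geodesic (@permutohedral_adj N) x y p -> size p = #|inversions x y|.
Proof.
case=> -[path_p <-] min_p; have [q walk_q size_q] := inversions_walk x (last x p).
by apply/eqP; rewrite eqn_leq card_inversions_walk // andbT -size_q min_p.
Qed.

(** If [z] reversed the pair, the detour through [z] would invert it and invert it back, so it could
    not be shortest. *)
Lemma between_enum_lt x y z u v : between (@permutohedral_adj N) x y z ->
  enum_lt x u v -> enum_lt y u v -> enum_lt z u v.
Proof.
case=> p geo_p z_p xuv yuv; apply: contraT => zNuv.
have zvu : enum_lt z v u.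
  by have := enum_lt_total z (enum_lt_neq xuv); rewrite (negbTE zNuv).
have size_p := size_geodesic geo_p; have [[path_p last_p] _] := geo_p.
case/splitPl: z_p path_p last_p size_p => p1 p2 last1.
rewrite cat_path last_cat size_cat last1 => /andP[path1 path2] last2 size_p.
have := card_inversions_walk path1; have := card_inversions_walk path2.
rewrite last1 last2 => le2 le1.
suff : #|inversions x y| < #|inversions x z| + #|inversions z y|.
  by rewrite -size_p ltnNge leq_add.
have uv_xz : (u, v) \in inversions x z by rewrite mem_inversions xuv.
(* As [(u, v)] is not an inversion of [x] and [y], the triangle inclusion survives its removal,
   which makes the inequality strict. *)
rewrite (cardsD1 (u, v) (inversions x z)) uv_xz add1n ltnS.
apply: leq_trans (leq_card_setU _ _); apply/subset_leq_card/subsetP=> -[a b] ab.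
have := subsetP (inversions_triangle x z y) _ ab; rewrite !in_setU in_setD1.
case: eqP ab => [[-> ->]|_ _ -> //].
by rewrite mem_inversions (enum_lt_asym yuv) andbF.
Qed.

Lemma between_swap x y u v : consecutive x u v -> enum_lt y v u ->
  between (@permutohedral_adj N) x y (swap x u v).
Proof.
move=> uv yvu; have [p [path_p last_p] size_p] := inversions_walk (swap x u v) y.
exists (swap x u v :: p); last by rewrite !inE eqxx orbT.
split; first by split; rewrite //= adj_swap.
move=> q [path_q last_q]; rewrite /= size_p -(card_inversions_swap uv yvu) -last_q.
exact: card_inversions_walk.
Qed.

(** * Convex sets and sets [Lset T] *)

Lemma mem_LsetP (T : {set N * N}) e :
  reflect (forall u v, (u, v) \in T -> enum_le e u v) (e \in Lset T).
Proof.
by rewrite inE; apply: (iffP forall_inP) => [eT u v /eT|eT [u v] /eT].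
Qed.

Lemma Lset_convex T : geodetically_convex (@permutohedral_adj N) (Lset T).
Proof.
move=> x y /mem_LsetP xT /mem_LsetP yT z xyz; apply/mem_LsetP=> u v uvT.
have [->|uv] := eqVneq u v; first exact: leqnn.
have : enum_lt z u v.
  by apply: (between_enum_lt xyz); rewrite enum_lt_neqAle uv ?xT ?yT.
by rewrite enum_lt_neqAle uv.
Qed.

Definition common_le S : {set N * N} :=
  [set p | [forall e in S, enum_le e p.1 p.2]].

Lemma mem_common_leP S u v :
  reflect (forall e, e \in S -> enum_le e u v) ((u, v) \in common_le S).
Proof. by rewrite inE; apply: forall_inP. Qed.

(** Antisymmetry is inherited from any one member of [S]; for empty [S] the relation would contain
    all pairs. *)
Lemma common_le_poset S : S != set0 -> is_poset (common_le S).
Proof.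
case/set0Pn=> x Sx; split=> [u|u v|u v w].
- by apply/mem_common_leP=> e _; apply: leqnn.
- move=> /mem_common_leP/(_ x Sx) uv /mem_common_leP/(_ x Sx) vu.
  by apply/(@enum_inv_inj x)/val_inj/eqP; rewrite eqn_leq; apply/andP.
move=> /mem_common_leP uv /mem_common_leP vw.
by apply/mem_common_leP=> e Se; apply: leq_trans (uv e Se) (vw e Se).
Qed.

Lemma convex_Lset S : S != set0 -> geodetically_convex (@permutohedral_adj N) S ->
  S = Lset (common_le S).
Proof.
case/set0Pn=> x0 Sx0 convS; apply/setP=> z; apply/idP/mem_LsetP => [Sz u v|zT].
  by move/mem_common_leP; apply.
have [x Sx min_x] := arg_minnP (fun x => #|inversions x z|) Sx0.
have [/inversions_eq0 <- //|[[a b]]] := set_0Vmem (inversions x z).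
rewrite mem_inversions => /andP[xab zba].
have [u [v [uv zvu]]] := inversion_consecutive xab zba.
have : (u, v) \notin common_le S.
  by apply: contraTN zvu => /zT; rewrite enum_leNgt.
rewrite inE negb_forall_in => /exists_inP[y Sy]; rewrite enum_leNgt negbK => yvu.
(* The swapped enumeration is in [S] by convexity, against the minimality of [x]. *)
have := min_x _ (convS x y Sx Sy _ (between_swap uv yvu)).
by rewrite (card_inversions_swap uv zvu) ltnn.
Qed.

(** Exhibits the empty set as a member of [Xcirc]: two distinct elements cannot precede each
    other. *)
Lemma Lset_setT : 1 < #|N| -> Lset [set: N * N] = set0.
Proof.
case/card_gt1P=> u [v [_ _ uv]]; apply/setP=> e; rewrite [RHS]inE.
apply/mem_LsetP=> le_e; have := le_e u v (in_setT _); have := le_e v u (in_setT _).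
by rewrite [enum_le e v u]enum_leNgt enum_lt_neqAle uv => /negP.
Qed.

(** * Existence of linear extensions *)

Lemma enumeration_of_seq (s : seq N) : uniq s -> s =i N ->
  exists e, forall u, enum_inv e u = index u s :> nat.
Proof.
move=> uniq_s mem_s.
have size_s : size s = #|N| by rewrite -(card_uniqP uniq_s); apply: eq_card.
pose f := [ffun i => tnth (in_tuple s) (cast_ord (esym size_s) i)].
have inj_f : injective f.
  move=> i j; rewrite !ffunE => /(tuple_uniqP (in_tuple s) uniq_s).
  exact: cast_ord_inj.
have bij_f : bijectiveb f by apply/bijectivebP/inj_card_bij; rewrite ?card_ord.
exists (Enumeration bij_f) => u; set e := Enumeration _.
rewrite -{2}(enum_invK e u) /= ffunE (tnth_nth u) index_uniq //=.
by rewrite size_s.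
Qed.

(** The size of the principal down-set increases strictly along [P], so sorting by it gives a linear
    extension, however ties are broken. *)
Lemma poset_linear_extension (P : {set N * N}) : is_poset P -> Lset P != set0.
Proof.
case=> reflP antiP transP.
pose f u := #|[set w | (w, u) \in P]|.
have f_mono u v : (u, v) \in P -> u != v -> f u < f v.
  move=> uv neq_uv; apply: proper_card; apply/properP; split.
    by apply/subsetP=> w; rewrite !inE => /transP; apply.
  (* By antisymmetry [v] lies in its own down-set but not in that of [u]. *)
  exists v; rewrite inE ?reflP //; apply: contraNN neq_uv => vu.
  by rewrite (antiP u v).
pose s := sort (relpre f leq) (enum N).
have [||e eE] := @enumeration_of_seq s; first by rewrite sort_uniq enum_uniq.
  by move=> u; rewrite mem_sort mem_enum.
apply/set0Pn; exists e; apply/mem_LsetP=> u v uv.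
have [->|neq_uv] := eqVneq u v; first exact: leqnn.
rewrite enum_leNgt /enum_lt !eE; apply/negP=> vu.
have := f_mono _ _ uv neq_uv; rewrite ltnNge => /negP; apply.
have mem_s w : w \in s by rewrite mem_sort mem_enum.
have sorted_s : sorted (relpre f leq) s by apply: sort_sorted => a b; apply: leq_total.
have tr : transitive (relpre f leq) by move=> a b c; apply: leq_trans.
by have := sorted_ltn_index tr sorted_s _ _ (mem_s v) (mem_s u) vu.
Qed.

End Inversions.

Theorem theorem3 (N : finType) (hN : 2 <= #|N|) :
  (forall S : {set enumeration N},
     Xcirc S <-> geodetically_convex (@permutohedral_adj N) S) /\
  (forall S : {set enumeration N},
     (exists P : {set N * N}, is_poset P /\ S = Lset P) <->
     (S != set0 /\ geodetically_convex (@permutohedral_adj N) S)).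
Proof.
split=> S; split.
- by case=> T ->; apply: Lset_convex.
- have [-> _|S0 convS] := eqVneq S set0; first by exists setT; rewrite Lset_setT.
  by exists (common_le S); apply: convex_Lset.
- by case=> P [posP ->]; split; [apply: poset_linear_extension | apply: Lset_convex].
- case=> S0 convS; exists (common_le S); split; first exact: common_le_poset.
  exact: convex_Lset.
Qed.
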